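(* Let $G=(V,E)$ be a connected $d$-regular graph and $k\in\mathbb{R}$ such that $\kappa(v_1,v_2)\ge k$ for all distinct $v_1,v_2\in V$. Fix $x\in V$ and let $S_i=\{v\in V:\mathrm{dist}(x,v)=i\}$. Then for all $i\geq 1$, $$|S_i|\leq d^i\Bigl(\frac{1+\tfrac{1}{d}-2k}{2}\Bigr)^{i-1}.$$ If moreover $G$ is bipartite, then for all $i\geq1$, $$|S_i|\leq d^i\Bigl(\frac{1-k}{2}\Bigr)^{i-1}.$$
   Context: $\mathrm{dist}$ is the graph distance. For a vertex $x$ of degree $d_x$, $\mu_x$ is the probability measure on $V$ with $\mu_x(x)=\tfrac12$, $\mu_x(v)=\tfrac{1}{2d_x}$ if $v\sim x$, and $\mu_x(v)=0$ otherwise. For probability measures of finite support, $W_1(\mu,\nu)=\inf_m\sum_{u,v}\mathrm{dist}(u,v)\,m(u,v)$ over couplings $m$ of $\mu,\nu$. The Ollivier curvature of distinct vertices is $\kappa(x,y)=1-\frac{W_1(\mu_x,\mu_y)}{\mathrm{dist}(x,y)}$. *)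

(* Defs.v *)
From HB Require Import structures.
From mathcomp Require Import all_boot all_order all_algebra finmap.
From mathcomp Require Import all_classical all_reals.

Set Implicit Arguments.
Unset Strict Implicit.
Unset Printing Implicit Defensive.

Import Order.TTheory GRing.Theory Num.Theory.

Local Open Scope classical_set_scope.
Local Open Scope ring_scope.

(* Simple graphs; the vertex set may be infinite. *)
Record sgraph := SGraph {
  vertex :> choiceType;
  adj : rel vertex;
  adj_sym : symmetric adj;
  adj_irrefl : irreflexive adj }.

Section Graph.
Variable G : sgraph.
Implicit Types (x y u v : G) (n d : nat).

Definition neighbors x : set G := [set y | adj x y].

(* Meaningful only when [neighbors x] is finite ([fset_set] of an infinite set
   is empty); [regular] below includes this finiteness. *)
Definition degree x : nat := #|` fset_set (neighbors x)|.

Definition regular d : Prop :=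
  forall x, finite_set (neighbors x) /\ degree x = d.

Definition has_walk x y n : Prop :=
  exists p : seq G, [/\ path (@adj G) x p, last x p = y & size p = n].

Definition graph_connected : Prop := forall x y, exists n, has_walk x y n.

Definition bipartite : Prop :=
  exists A : pred G, forall x y, adj x y -> A x != A y.

(* Length of a shortest walk; 0 is a junk value when there is none. *)
Definition dist x y : nat :=
  if pselect (exists n, `[< has_walk x y n >]) is left h then ex_minn h else 0%N.

Definition sphere x n : set G := [set v | dist x v = n].

End Graph.

Section Ollivier.
Variables (R : realType) (G : sgraph).
Implicit Types (x y u v : G) (mu nu : G -> R).

(* The point masses of the lazy random walk measure at [x]. *)
Definition lazy_measure x v : R :=
  if v == x then 2^-1
  else if adj x v then (2 * (degree x)%:R)^-1 else 0.

(* For finitely supported [mu] and [nu] every coupling is finitely supported,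
   so the first clause is no restriction; it is stated because the [\sum_(_ \in _)]
   of [fsbigop] is 0 when the support of the summand is infinite. *)
Definition coupling mu nu (m : G * G -> R) : Prop :=
  [/\ finite_set [set p | m p != 0],
      forall p, 0 <= m p,
      forall u, \sum_(v \in [set: G]) m (u, v) = mu u
    & forall v, \sum_(u \in [set: G]) m (u, v) = nu v].

Definition transport_cost (m : G * G -> R) : R :=
  \sum_(p \in [set: G * G]) (dist p.1 p.2)%:R * m p.

Definition W1 mu nu : R :=
  inf [set transport_cost m | m in coupling mu nu].

Definition ollivier_curvature x y : R :=
  1 - W1 (lazy_measure x) (lazy_measure y) / (dist x y)%:R.

End Ollivier.

(* Main.v *)
(** Call [y] in [S_i] a parent of [w] in [S_(i+1)], and [w] a child of [y], when
    they are adjacent.  Give the edge from [y] to [w] weight 2 if [y] is the only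
    parent of [w] and weight 1 otherwise.  Every [w] then receives total weight
    at least 2, so [2 |S_(i+1)|] is at most the sum over [y] in [S_i] of the
    weight [y] sends to its children.  That weight is bounded by weak
    Kantorovich duality for the lazy measures at [y] and at a parent [z] of [y],
    since a child of [y] with no other parent is far from the neighbors of [z].
    Hence [|S_(i+1)| <= d c |S_i|] with [c] the base of the claimed power. *)

Require Import Defs.
From HB Require Import structures.
From mathcomp Require Import all_boot all_order all_algebra finmap.
From mathcomp Require Import all_classical all_reals.
From mathcomp Require Import zify ring lra.

Set Implicit Arguments.
Unset Strict Implicit.
Unset Printing Implicit Defensive.

Import Order.TTheory GRing.Theory Num.Theory.

Local Open Scope classical_set_scope.
Local Open Scope ring_scope.

(** * Distances, last steps of shortest walks, and parity *)

Section Distance.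
Variable G : sgraph.
Hypothesis hconn : graph_connected G.
Implicit Types (x y z u v w : G) (n : nat).

Lemma dist_walk x y : has_walk x y (dist x y).
Proof.
rewrite /dist; case: pselect => [h|h].
  by case: ex_minnP => n /asboolP.
by have [n hn] := hconn x y; case: h; exists n; apply/asboolP.
Qed.

Lemma dist_le_walk x y n : has_walk x y n -> (dist x y <= n)%N.
Proof.
move=> hn; rewrite /dist; case: pselect => // h.
by case: ex_minnP => m _; apply; apply/asboolP.
Qed.

Lemma distxx x : dist x x = 0%N.
Proof. by apply/eqP; rewrite -leqn0; apply: dist_le_walk; exists [::]. Qed.

Lemma dist_eq0 x y : (dist x y == 0%N) = (x == y).
Proof.
apply/idP/eqP => [/eqP d0|->]; last by rewrite distxx.
by have [[|? ?] [_ + +]] := dist_walk x y; rewrite d0.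
Qed.

Lemma dist_gt0 x y : x != y -> (0 < dist x y)%N.
Proof. by rewrite lt0n dist_eq0. Qed.

Lemma dist_step x y z : adj y z -> (dist x z <= (dist x y).+1)%N.
Proof.
move=> yz; have [p [pp lp sp]] := dist_walk x y.
apply: dist_le_walk; exists (rcons p z).
by rewrite rcons_path pp lp yz last_rcons size_rcons sp.
Qed.

(** Drop the last step of a shortest walk: by [dist_step] its end cannot be closer to [x] than [n].
    Applied to spheres, this gives every vertex other than the centre a parent. *)
Lemma dist_parent x y n : dist x y = n.+1 -> exists2 z, adj z y & dist x z = n.
Proof.
move=> dy; have [p [+ + +]] := dist_walk x y.
rewrite dy; case/lastP: p => // p w.
rewrite rcons_path last_rcons size_rcons => /andP[pp pw] wy [sp]; subst w.
exists (last x p) => //; apply/eqP; rewrite eqn_leq; apply/andP; split.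
  by apply: dist_le_walk; exists p.
by rewrite -ltnS -dy; apply: dist_step.
Qed.

Lemma adj_neq x y : adj x y -> x != y.
Proof. by apply: contraTneq => ->; rewrite adj_irrefl. Qed.

Lemma dist1P x y : reflect (dist x y = 1%N) (adj x y).
Proof.
apply: (iffP idP) => [xy|/dist_parent[z zy /eqP]].
  apply/eqP; rewrite eqn_leq dist_gt0 ?adj_neq// andbT.
  by have := dist_step x xy; rewrite distxx.
by rewrite dist_eq0 => /eqP ->.
Qed.

Lemma dist_gt1 x y : x != y -> ~~ adj x y -> (1 < dist x y)%N.
Proof.
move=> /dist_gt0; rewrite leq_eqVlt => /predU1P[/esym/dist1P ->//|//].
Qed.

(** Distance exactly 2 is excluded by parity: two steps would return to the colour of [x]. *)
Lemma dist_gt2 (C : pred G) x y :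
  (forall u v, adj u v -> C u != C v) -> C x != C y -> ~~ adj x y ->
  (2 < dist x y)%N.
Proof.
move=> hC Cxy nxy.
have xy : x != y by apply: contraNneq Cxy => ->.
rewrite ltn_neqAle dist_gt1// andbT; apply/eqP => /esym/dist_parent[z zy].
move=> /dist1P/hC; move: (hC _ _ zy) Cxy.
by case: (C x); case: (C y); case: (C z).
Qed.

End Distance.

(** * Weak Kantorovich duality *)

Section Transport.
Variables (R : realType) (G : sgraph).
Implicit Types (mu nu phi psi : G -> R) (m : G * G -> R).

(** By the marginal conditions the left side is the sum of [(psi v - phi u) * m (u, v)]. Two
    potentials need comparison only across the two supports, whereas a single one would have to be
    1-Lipschitz. *)
Lemma transport_cost_ge mu nu m phi psi (A B : {fset G}) :
  coupling mu nu m ->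
  (forall u, u \notin A -> mu u = 0) -> (forall v, v \notin B -> nu v = 0) ->
  (forall u v, u \in A -> v \in B -> psi v - phi u <= (dist u v)%:R) ->
  \sum_(v <- B) psi v * nu v - \sum_(u <- A) phi u * mu u <= transport_cost m.
Proof.
move=> [finm m0 m1 m2] muA nuB hd.
(* A row of nonnegative entries with sum 0 vanishes; likewise for columns. So [m] lives on [A] times
   [B] and all sums become finite. *)
have mA u v : u \notin A -> m (u, v) = 0.
  move=> uA; have := m1 u; rewrite muA//.
  pose X := fset_set (snd @` [set p | m p != 0]).
  have XE w : w \notin X -> m (u, w) = 0.
    apply: contraNeq => muw; rewrite in_fset_set ?inE//=; last exact: finite_image.
    by exists (u, w).
  rewrite (fsbigTE X)// => /eqP.
  rewrite psumr_eq0// => /allP/= hX.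
  by have [/hX/eqP//|/XE] := boolP (v \in X).
have mB u v : v \notin B -> m (u, v) = 0.
  move=> vB; have := m2 v; rewrite nuB//.
  pose X := fset_set (fst @` [set p | m p != 0]).
  have XE w : w \notin X -> m (w, v) = 0.
    apply: contraNeq => muw; rewrite in_fset_set ?inE//=; last exact: finite_image.
    by exists (w, v).
  rewrite (fsbigTE X)// => /eqP.
  rewrite psumr_eq0// => /allP/= hX.
  by have [/hX/eqP//|/XE] := boolP (u \in X).
have -> : transport_cost m =
    \sum_(u <- A) \sum_(v <- B) (dist u v)%:R * m (u, v).
  rewrite /transport_cost (fsbigE [seq (u, v) | u <- A, v <- B]) //.
  - by under eq_bigl do rewrite in_setT; rewrite big_allpairs.
  - by apply: allpairs_uniq => // -[? ?] [? ?].
  - move=> [u v] _ /=; have [uA|uA] := boolP (u \in A); last by rewrite mA ?mulr0.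
    have [vB|vB] := boolP (v \in B); last by rewrite mB ?mulr0.
    by move=> /negP[]; apply/allpairsP; exists (u, v).
have -> : \sum_(v <- B) psi v * nu v = \sum_(u <- A) \sum_(v <- B) psi v * m (u, v).
  rewrite exchange_big/=; apply: eq_bigr => v _.
  by rewrite -m2 (fsbigTE A) ?mulr_sumr// => u /mA.
have -> : \sum_(u <- A) phi u * mu u = \sum_(u <- A) \sum_(v <- B) phi u * m (u, v).
  by apply: eq_bigr => u _; rewrite -m1 (fsbigTE B) ?mulr_sumr// => v /mB.
rewrite -sumrB big_seq [leRHS]big_seq; apply: ler_sum => u uA.
rewrite -sumrB big_seq [leRHS]big_seq; apply: ler_sum => v vB.
by rewrite -mulrBl ler_wpM2r// hd.
Qed.

(** Shows that the infimum in [W1] is over a nonempty set; on the empty set [inf] has the default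
    value 0. *)
Lemma product_coupling mu nu (A B : {fset G}) :
  (forall u, u \notin A -> mu u = 0) -> (forall v, v \notin B -> nu v = 0) ->
  (forall u, 0 <= mu u) -> (forall v, 0 <= nu v) ->
  \sum_(u <- A) mu u = 1 -> \sum_(v <- B) nu v = 1 ->
  coupling mu nu (fun p => mu p.1 * nu p.2).
Proof.
move=> muA nuB mu0 nu0 mu1 nu1; split => /=.
- apply: (sub_finite_set (B := [set` A] `*` [set` B])); last first.
    by apply: finite_setX; exact: finite_fset.
  move=> [u v] /=; rewrite mulf_eq0 negb_or => /andP[hu hv].
  by split; [move: hu; apply: contraNT => /muA ->|move: hv; apply: contraNT => /nuB ->].
- by move=> p; rewrite mulr_ge0.
- by move=> u; rewrite -mulr_fsumr (fsbigTE B)// nu1 mulr1.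
- by move=> v; rewrite -mulr_fsuml (fsbigTE A)// mu1 mul1r.
Qed.

Lemma W1_ge mu nu phi psi (A B : {fset G}) :
  (forall u, u \notin A -> mu u = 0) -> (forall v, v \notin B -> nu v = 0) ->
  (forall u, 0 <= mu u) -> (forall v, 0 <= nu v) ->
  \sum_(u <- A) mu u = 1 -> \sum_(v <- B) nu v = 1 ->
  (forall u v, u \in A -> v \in B -> psi v - phi u <= (dist u v)%:R) ->
  \sum_(v <- B) psi v * nu v - \sum_(u <- A) phi u * mu u <= W1 mu nu.
Proof.
move=> muA nuB mu0 nu0 mu1 nu1 hd; apply: lb_le_inf.
  pose m p : R := mu p.1 * nu p.2.
  exists (transport_cost m); exists m => //.
  exact: product_coupling muA nuB mu0 nu0 mu1 nu1.
by move=> _ [m cm <-]; apply: transport_cost_ge.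
Qed.

End Transport.

(** * Lazy measures on a regular graph and duality along an edge *)

Section Regular.
Variables (R : realType) (G : sgraph) (d : nat).
Hypothesis hreg : regular G d.
Implicit Types (x y z u v : G).

Definition nbhd x : {fset G} := fset_set (neighbors x).

Lemma in_nbhd x y : (y \in nbhd x) = adj x y.
Proof.
rewrite in_fset_set; last by have [] := hreg x.
by apply/idP/idP; rewrite inE.
Qed.

Lemma card_nbhd x : #|` nbhd x| = d.
Proof. by have [] := hreg x. Qed.

Lemma nbhd_self x : x \notin nbhd x.
Proof. by rewrite in_nbhd adj_irrefl. Qed.

Lemma lazy_measure_ge0 x v : 0 <= lazy_measure R x v.
Proof.
rewrite /lazy_measure; case: ifP => _; first by rewrite invr_ge0.
by case: ifP => // _; rewrite invr_ge0 mulr_ge0.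
Qed.

Lemma lazy_measure_supp x v : v \notin (x |` nbhd x)%fset -> lazy_measure R x v = 0.
Proof.
by rewrite !inE negb_or in_nbhd /lazy_measure => /andP[/negPf-> /negPf->].
Qed.

Lemma sum_lazy_measure x (f : G -> R) :
  \sum_(v <- (x |` nbhd x)%fset) f v * lazy_measure R x v =
  f x / 2 + (\sum_(v <- nbhd x) f v) / (2 * d%:R).
Proof.
rewrite big_fsetU1 ?nbhd_self//= {1}/lazy_measure eqxx; congr (_ + _).
rewrite mulr_suml big_seq [RHS]big_seq; apply: eq_bigr => v; rewrite in_nbhd => xv.
rewrite /lazy_measure xv; have [_ ->] := hreg x.
by case: eqP xv => // ->; rewrite adj_irrefl.
Qed.

Lemma lazy_measure_sum1 x : (0 < d)%N ->
  \sum_(v <- (x |` nbhd x)%fset) lazy_measure R x v = 1.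
Proof.
move=> d0; have d0R : d%:R != 0 :> R by rewrite pnatr_eq0 -lt0n.
under eq_bigr do rewrite -[lazy_measure _ _ _]mul1r.
rewrite (sum_lazy_measure x (fun=> 1)) big_const_seq count_predT.
by rewrite iter_addr_0 card_nbhd; field.
Qed.

Hypothesis hconn : graph_connected G.

(** At distance 1 the curvature bound reads [W1 <= 1 - k]. Multiplying duality by [2 * d] clears
    denominators; the factor [d] at [y] and [z] reflects the mass 1/2 that each measure keeps at its
    centre. *)
Lemma edge_duality (k : R) z y (phi psi : G -> R) :
  (0 < d)%N -> adj z y -> k <= ollivier_curvature R z y ->
  (forall u v, u = z \/ adj z u -> v = y \/ adj y v ->
     psi v - phi u <= (dist u v)%:R) ->
  psi y * d%:R + \sum_(v <- nbhd y) psi v -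
  (phi z * d%:R + \sum_(u <- nbhd z) phi u) <= 2 * d%:R * (1 - k).
Proof.
move=> d0 zy; rewrite /ollivier_curvature (dist1P hconn z y zy) divr1 => hk hd.
have d0R : 0 < d%:R :> R by rewrite ltr0n.
have : psi y / 2 + (\sum_(v <- nbhd y) psi v) / (2 * d%:R) -
    (phi z / 2 + (\sum_(u <- nbhd z) phi u) / (2 * d%:R)) <= 1 - k.
  rewrite -!sum_lazy_measure.
  apply: le_trans (_ : W1 (lazy_measure R z) (lazy_measure R y) <= _); last first.
    by rewrite lerBrDl -lerBrDr.
  apply: W1_ge; try exact: lazy_measure_supp; try exact: lazy_measure_ge0;
    try exact: lazy_measure_sum1.
  move=> u v; rewrite !inE !in_nbhd => hu hv.
  by apply: hd; [case/orP: hu => [/eqP|]|case/orP: hv => [/eqP|]]; auto.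
move=> h; rewrite -(ler_pM2l (_ : 0 < 2 * d%:R)) in h; last by rewrite mulr_gt0.
apply: le_trans h; rewrite le_eqVlt; apply/orP; left; apply/eqP; field.
by rewrite lt0r_neq0.
Qed.

(** * Spheres as finite sets *)

Lemma sphere0 x : sphere x 0 = [set x].
Proof.
apply/seteqP; split => [v /= /eqP|_ ->]; last exact: distxx.
by rewrite dist_eq0// => /eqP.
Qed.

Lemma finite_sphere x i : finite_set (sphere x i).
Proof.
elim: i => [|i IH]; first by rewrite sphere0.
apply: (sub_finite_set (B := \bigcup_(y in sphere x i) neighbors y)).
  by move=> v /= /(dist_parent hconn)[z zv dz]; exists z.
by apply: bigcup_finite => // y _; have [] := hreg y.
Qed.

Definition fsphere x i : {fset G} := fset_set (sphere x i).

Lemma in_fsphere x i v : (v \in fsphere x i) = (dist x v == i).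
Proof.
rewrite in_fset_set; last exact: finite_sphere.
by apply/idP/eqP; rewrite inE.
Qed.

Lemma fsphere1 x : fsphere x 1 = nbhd x.
Proof.
apply/fsetP => v; rewrite in_fsphere in_nbhd.
by apply/eqP/idP => /(dist1P hconn).
Qed.

(** * Parent weights: double counting, growth of spheres, bounds on child weights *)

Definition has_other_parent x y w : bool :=
  `[< exists y', [/\ y' != y, adj y' w & dist x y' = dist x y] >].

(* Chosen so that the weights of the edges from the parents of [w] to [w]
   add up to at least 2 in all cases. *)
Definition parent_weight x y w : nat := if has_other_parent x y w then 1 else 2.

Lemma sum_parent_weight x i w : dist x w = i.+1 ->
  (2 <= \sum_(y <- fsphere x i | adj y w) parent_weight x y w)%N.
Proof.
move=> dw; have [y yw dy] := dist_parent hconn dw.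
have yS : y \in fsphere x i by rewrite in_fsphere dy.
rewrite big_mkcond (big_fsetD1 y)//= yw /parent_weight.
case: ifPn => [/asboolP[y' [y'y y'w dy']]|_]; last by rewrite leq_addr.
have y'S : y' \in (fsphere x i `\ y)%fset by rewrite !inE y'y in_fsphere dy' dy /=.
rewrite (big_fsetD1 y')//= y'w.
by case: ifP => _; rewrite ?addnA leq_addr.
Qed.

Lemma card_sphere_double_count x i :
  (2 * #|` fsphere x i.+1| <=
   \sum_(y <- fsphere x i) \sum_(w <- nbhd y | dist x w == i.+1)
     parent_weight x y w)%N.
Proof.
have -> : (\sum_(y <- fsphere x i) \sum_(w <- nbhd y | dist x w == i.+1)
     parent_weight x y w =
   \sum_(w <- fsphere x i.+1) \sum_(y <- fsphere x i | adj y w)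
     parent_weight x y w)%N.
  rewrite (exchange_big_dep xpredT)//=; apply: eq_bigr => y _.
  rewrite -big_filter -[RHS]big_filter; apply: perm_big.
  apply: uniq_perm; rewrite ?filter_uniq ?fset_uniq// => w.
  by rewrite !mem_filter in_nbhd in_fsphere andbC.
rewrite mulnC -sum1_size big_distrl/= big_seq [leqRHS]big_seq.
apply: leq_sum => w; rewrite in_fsphere => /eqP dw.
by rewrite mul1n sum_parent_weight.
Qed.

Lemma sphere_growth (x : G) (c : R) : (0 < d)%N ->
  (forall i y, dist x y = i.+1 ->
     (\sum_(w <- nbhd y | dist x w == i.+2) parent_weight x y w)%N%:R
       <= 2 * (d%:R * c)) ->
  forall i, (1 <= i)%N ->
    #|` fset_set (sphere x i)|%:R <= d%:R ^+ i * c ^+ (i - 1).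
Proof.
move=> d0 hc [//|i] _; rewrite subSS subn0 -/(fsphere x i.+1).
(* The sign of [c] is not given, but the hypothesis at any neighbor of [x] bounds a natural number
   by [2 * (d * c)]. The induction multiplies by [d * c]. *)
have dc0 : 0 <= d%:R * c.
  have [y] : exists y, y \in nbhd x.
    by apply/fset0Pn; rewrite -cardfs_gt0 card_nbhd.
  rewrite in_nbhd => /(dist1P hconn)/hc.
  by move=> h; have := le_trans (ler0n _ _) h; rewrite pmulr_rge0.
elim: i => [|i IH]; first by rewrite fsphere1 card_nbhd expr1 expr0 mulr1.
have := card_sphere_double_count x i.+1.
rewrite -(ler_nat R) natrM natr_sum => h.
have h2 : \sum_(y <- fsphere x i.+1)
    (\sum_(w <- nbhd y | dist x w == i.+2) parent_weight x y w)%N%:R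
    <= #|` fsphere x i.+1|%:R * (2 * (d%:R * c)).
  rewrite -sum1_size natr_sum mulr_suml big_seq [leRHS]big_seq.
  by apply: ler_sum => y; rewrite in_fsphere mul1r => /eqP/hc.
have h3 := ler_wpM2r dc0 IH.
have -> : d%:R ^+ i.+2 * c ^+ i.+1 = d%:R ^+ i.+1 * c ^+ i * (d%:R * c).
  by rewrite !exprS; ring.
lra.
Qed.

(* Weak duality along an edge from a parent [z] of [y]: a child of [y] without
   another parent is at distance at least 2 from every neighbor of [z] but [y]. *)
Lemma sum_child_weight (k : R) x i y : (0 < d)%N ->
  (forall z, adj z y -> k <= ollivier_curvature R z y) ->
  dist x y = i.+1 ->
  (\sum_(w <- nbhd y | dist x w == i.+2) parent_weight x y w)%N%:R
    <= 2 * (d%:R * ((1 + 1 / d%:R - 2 * k) / 2)) :> R.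
Proof.
move=> d0 hk dy; have [z zy dz] := dist_parent hconn dy.
have zy_neq : z != y by exact: adj_neq.
(* With [s] the total child weight, these potentials turn [edge_duality] into
   [d + s - 1 <= 2 * d * (1 - k)]. *)
pose phi u : R := (u == y)%:R.
pose psi v : R :=
  if dist x v == i.+2 then (parent_weight x y v)%:R else (v == y)%:R.
have := edge_duality (phi := phi) (psi := psi) d0 zy (hk z zy).
have -> : phi z = 0 by rewrite /phi (negPf zy_neq).
have -> : psi y = 1 by rewrite /psi dy eqxx eqn_leq ltnn andbF.
have -> : \sum_(u <- nbhd z) phi u = 1.
  rewrite (big_fsetD1 y) ?in_nbhd//= {1}/phi eqxx big1_seq ?addr0// => u /=.
  by rewrite !inE /phi => /andP[/negPf->].
have -> : \sum_(v <- nbhd y) psi v =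
    (\sum_(w <- nbhd y | dist x w == i.+2) parent_weight x y w)%N%:R.
  rewrite natr_sum [RHS]big_mkcond big_seq [RHS]big_seq.
  apply: eq_bigr => v; rewrite in_nbhd /psi => yv.
  by case: ifP => // _; rewrite eq_sym (negPf (adj_neq yv)).
move=> hd; set s := (X in X%:R <= _); rewrite -/s in hd.
have d0R : d%:R != 0 :> R by rewrite pnatr_eq0 -lt0n.
have -> : 2 * (d%:R * ((1 + 1 / d%:R - 2 * k) / 2)) = d%:R + 1 - 2 * d%:R * k.
  by field.
suff /hd : forall u v, u = z \/ adj z u -> v = y \/ adj y v ->
  psi v - phi u <= (dist u v)%:R by lra.
move=> u v zu yv; rewrite lerBlDr /psi /phi.
have du : (dist x u <= i.+1)%N.
  by case: zu => [->|/(dist_step hconn x)]; rewrite dz.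
case: ifPn => [/eqP dv|_]; last first.
  have [->|vy] := eqVneq v y; last by rewrite addr_ge0.
  have [->|uy] := eqVneq u y; first by rewrite lerDr.
  by rewrite addr0 ler1n dist_gt0.
have {}yv : adj y v.
  by case: yv dv => // ->; rewrite dy => /eqP; rewrite eqn_leq ltnn andbF.
rewrite -natrD ler_nat.
have uv : u != v by apply: contraTneq du => ->; rewrite dv ltnn.
have [uy|uy] := eqVneq u y.
  by rewrite addn1 /parent_weight; have := dist_gt0 hconn uv; case: ifP => // _; lia.
rewrite addn0 /parent_weight; case: ifPn => [_|nw]; first exact: dist_gt0.
(* If [u] were adjacent to [v], it would lie at distance exactly [i.+1] from [x] and be another
   parent of [v]. *)
apply: dist_gt1 => //; apply: contraNN nw => auv; apply/asboolP; exists u; split=> //.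
apply/eqP; rewrite eqn_leq dy du/=.
by have := dist_step hconn x auv; rewrite dv.
Qed.

(* Parity improves the previous distance bound from 2 to 3, which makes room for
   the value -1 of the potential on the neighbors of [z] other than [y]. *)
Lemma sum_child_weight_bipartite (k : R) x i y : bipartite G -> (0 < d)%N ->
  (forall z, adj z y -> k <= ollivier_curvature R z y) ->
  dist x y = i.+1 ->
  (\sum_(w <- nbhd y | dist x w == i.+2) parent_weight x y w)%N%:R
    <= 2 * (d%:R * ((1 - k) / 2)) :> R.
Proof.
move=> [C hC] d0 hk dy; have [z zy dz] := dist_parent hconn dy.
have zy_neq : z != y by exact: adj_neq.
have adjC (a b : G) : adj a b -> C b = ~~ C a.
  by move=> /hC; case: (C a); case: (C b).
(* With [s] the child weight and [t] the number of children, duality gives [d + 2 * (s - t) - (2 -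
   d) <= 2 * d * (1 - k)]; then [t <= d - 1] yields [s <= d * (1 - k)]. A child gets potential 2 if
   [y] is its only parent, and 0 otherwise. *)
pose phi u : R := if u == z then 0 else if u == y then 1 else -1.
pose psi v : R :=
  if dist x v == i.+2 then 2 * ((parent_weight x y v)%:R - 1) else (v == y)%:R.
have := edge_duality (phi := phi) (psi := psi) d0 zy (hk z zy).
have -> : phi z = 0 by rewrite /phi eqxx.
have psi_y : psi y = 1 by rewrite /psi dy eqxx eqn_leq ltnn andbF.
rewrite psi_y.
have -> : \sum_(u <- nbhd z) phi u = 2 - d%:R.
  rewrite (big_fsetD1 y) ?in_nbhd//= {1}/phi eq_sym (negPf zy_neq) eqxx.
  have -> : \sum_(u <- (nbhd z `\ y)%fset) phi u = \sum_(u <- (nbhd z `\ y)%fset) -1.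
    apply: eq_big_seq => u; rewrite !inE in_nbhd /phi => /andP[/negPf-> zu].
    by rewrite eq_sym (negPf (adj_neq zu)).
  rewrite big_const_seq count_predT iter_addr_0.
  have := cardfsD1 y (nbhd z); rewrite in_nbhd zy card_nbhd => ->.
  by rewrite natrD mulNrn /=; ring.
(* The parent [z] is a neighbor of [y] but not a child. *)
have up_le : (\sum_(w <- nbhd y | dist x w == i.+2) 1 <= d.-1)%N.
  rewrite -(card_nbhd y) (cardfsD1 z) in_nbhd adj_sym zy add1n /= -sum1_size.
  rewrite big_mkcond (big_fsetD1 z) ?in_nbhd 1?adj_sym//= dz.
  rewrite eqn_leq ltnNge leqnSn andbF add0n.
  by apply: leq_sum => w _; case: ifP.
have -> : \sum_(v <- nbhd y) psi v =
    2 * ((\sum_(w <- nbhd y | dist x w == i.+2) parent_weight x y w)%N%:R -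
    (\sum_(w <- nbhd y | dist x w == i.+2) 1)%N%:R).
  rewrite !natr_sum -sumrB mulr_sumr [RHS]big_mkcond big_seq [RHS]big_seq.
  apply: eq_bigr => v; rewrite in_nbhd /psi => yv.
  by case: ifP => // _; rewrite eq_sym (negPf (adj_neq yv)).
move=> hd; move: up_le; set t := (X in (X <= _)%N); rewrite -/t in hd.
set s := (X in X%:R <= _); rewrite -/s in hd.
rewrite -ltnS prednK// -(ler_nat R) -natr1 => td.
suff /hd : forall u v, u = z \/ adj z u -> v = y \/ adj y v ->
  psi v - phi u <= (dist u v)%:R by lra.
move=> u v zu yv; rewrite lerBlDr.
have du : (dist x u <= i.+1)%N.
  by case: zu => [->|/(dist_step hconn x)]; rewrite dz.
have Cy : C y = ~~ C z by exact: adjC.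
have psi_le1 : dist x v != i.+2 -> psi v <= 1.
  by rewrite /psi => /negPf ->; case: eqP.
have psi_nbr : dist x v != i.+2 -> adj y v -> psi v = 0.
  by rewrite /psi => /negPf -> yv'; rewrite eq_sym (negPf (adj_neq yv')).
have [dv|dv] := eqVneq (dist x v) i.+2.
  have {}yv : adj y v.
    by case: yv dv => // ->; rewrite dy => /eqP; rewrite eqn_leq ltnn andbF.
  have psi_le2 : psi v <= 2 by rewrite /psi dv eqxx /parent_weight; case: ifP; lra.
  have uv : u != v by apply: contraTneq du => ->; rewrite dv ltnn.
  have [->|uz] := eqVneq u z.
    rewrite /phi eqxx addr0; apply: le_trans psi_le2 _; rewrite ler_nat.
    apply: dist_gt1 => //; first by apply/eqP => zv; move: dz; rewrite zv dv; lia.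
    by apply/negP => /(dist_step hconn x); rewrite dz dv ltnn.
  have [uy|uy] := eqVneq u y.
    rewrite /phi (negPf uz) uy eqxx; apply: le_trans psi_le2 _.
    by rewrite natr1 ler_nat ltnS -uy dist_gt0.
  have {}zu : adj z u by case: zu uz => // ->; rewrite eqxx.
  rewrite /phi (negPf uz) (negPf uy) lerBrDr.
  have [hw|nw] := boolP (has_other_parent x y v).
    rewrite /psi dv eqxx /parent_weight hw subrr mulr0 add0r.
    by rewrite ler1n dist_gt0.
  (* Here [u] and [v] have opposite colours and, [y] being the only parent of [v], are not adjacent;
     so their distance is at least 3. *)
  apply: le_trans (_ : 2 + 1 <= _); first by rewrite lerD2r.
  rewrite natr1 ler_nat.
  apply: (dist_gt2 hconn hC); first by rewrite (adjC z u)// (adjC y v)// Cy; case: (C z).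
  apply: contraNN nw => auv; apply/asboolP; exists u; split=> //.
  apply/eqP; rewrite eqn_leq dy du/=.
  by have := dist_step hconn x auv; rewrite dv.
have [uz|uz] := eqVneq u z.
  rewrite uz /phi eqxx addr0; case: yv => [->|/(psi_nbr dv) -> //].
  by rewrite psi_y ler1n dist_gt0.
have [uy|uy] := eqVneq u y.
  rewrite /phi (negPf uz) uy eqxx; apply: le_trans (psi_le1 dv) _.
  by rewrite lerDr.
have {}zu : adj z u by case: zu uz => // ->; rewrite eqxx.
rewrite /phi (negPf uz) (negPf uy) lerBrDr.
case: yv => [->|yv].
  (* Both [u] and [y] are neighbors of [z], hence of equal colour and not adjacent. *)
  rewrite psi_y -[1 + 1]/(2%:R) ler_nat; apply: dist_gt1 => //.
  by apply/negP => /adjC; rewrite Cy (adjC z u)//; case: (C z).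
(* Equality of [u] and [v] would close a triangle on [z] and [y], or make [u] equal to [z]; the
   colours exclude both. *)
rewrite psi_nbr// add0r ler1n dist_gt0//.
by apply/eqP => uv; move: (adjC _ _ zu) (adjC _ _ yv); rewrite uv Cy; case: (C z) => ->.
Qed.
End Regular.

Theorem theorem4p6 (R : realType) (G : sgraph) (d : nat) (k : R)
    (hconn : graph_connected G) (hreg : regular G d)
    (hk : forall v1 v2 : G, v1 <> v2 -> k <= ollivier_curvature R v1 v2)
    (x : G) :
  (forall i : nat, (1 <= i)%N ->
     finite_set (sphere x i) /\
     #|` fset_set (sphere x i)|%:R <=
       d%:R ^+ i * ((1 + 1 / d%:R - 2 * k) / 2) ^+ (i - 1)) /\
  (bipartite G ->
   forall i : nat, (1 <= i)%N ->
     finite_set (sphere x i) /\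
     #|` fset_set (sphere x i)|%:R <=
       d%:R ^+ i * ((1 - k) / 2) ^+ (i - 1)).
Proof.
have hk' (z y : G) : adj z y -> k <= ollivier_curvature R z y.
  by move=> zy; apply: hk; apply/eqP; exact: adj_neq.
have [d0|d0] := posnP d.
  (* For [d = 0] no vertex has a parent, so spheres of positive radius are empty. The arbitrary
     factor [c] covers both bounds, including the one where [1 / d] has the default value 0. *)
  have sphere_empty i c : (1 <= i)%N -> finite_set (sphere x i) /\
      #|` fset_set (sphere x i)|%:R <= d%:R ^+ i * c :> R.
    case: i => // i _; suff -> : sphere x i.+1 = set0.
      by rewrite fset_set0 cardfs0 d0 expr0n mul0r.
    apply/seteqP; split => // v /= /(dist_parent hconn)[z zv _].
    have := card_nbhd hreg z; rewrite d0 => /cardfs0_eq nz.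
    by have := in_nbhd hreg z v; rewrite nz inE zv.
  by split=> [i|_ i]; exact: sphere_empty.
split=> [i i1|bip i i1]; (split; first exact: finite_sphere).
  apply: (sphere_growth hreg hconn) => // j y dy.
  by apply: (sum_child_weight hreg hconn) => // z; apply: hk'.
apply: (sphere_growth hreg hconn) => // j y dy.
by apply: (sum_child_weight_bipartite hreg hconn) => // z; apply: hk'.
Qed.
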